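(* Let $n,m,d\in\mathbb{Z}^+$ with $n,m,d\geq 2$, and let $T_{m,d}$ be the complete $m$-ary tree of height $d$. Then \[ \chi_n(T_{m,d})=\begin{cases} 2, & \text{if } n\geq 4 \text{ or } n \nmid (m+1) \text{ or } d=2,\\ 3, & \text{otherwise}. \end{cases}\]
   Context: $T_{m,d}$ is the rooted tree in which every vertex at distance less than $d$ from the root has exactly $m$ children and all leaves are at distance $d$ from the root. For a graph $G=(V,E)$, a $\mathbb{Z}$-labeling is a map $\ell:V\to\mathbb{Z}$; its order is the size of its range; it is proper if adjacent vertices get different labels. $N[v]$ is the closed neighborhood of $v$. A closed coloring with nonzero remainders mod $n$ is a labeling with $\sum_{w\in N[v]}\ell(w)\not\equiv 0 \pmod n$ for all $v\in V$. $\chi_n(G)$ denotes the minimum order of a proper closed coloring with nonzero remainders mod $n$ of $G$. *)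

(* Defs.v *)
From HB Require Import structures.
From mathcomp Require Import all_boot all_order all_algebra.

Set Implicit Arguments.
Unset Strict Implicit.
Unset Printing Implicit Defensive.

Import GRing.Theory Num.Theory.
Local Open Scope ring_scope.

Record sgraph := SGraph {
  vertex :> finType;
  adj : rel vertex;
  adj_sym : symmetric adj;
  adj_irrefl : irreflexive adj
}.

Definition closed_nbhd (G : sgraph) (v : G) : {set G} :=
  [set w | (w == v) || adj v w].

Definition labeling_order (G : sgraph) (l : G -> int) : nat := size (undup (codom l)).

Definition proper_labeling (G : sgraph) (l : G -> int) : Prop :=
  forall u v : G, adj u v -> l u <> l v.

Definition closed_nonzero_coloring (n : nat) (G : sgraph) (l : G -> int) : Prop :=
  forall v : G, (\sum_(w in closed_nbhd v) l w <> 0 %[mod n%:Z])%Z.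

Definition admissible (n : nat) (G : sgraph) (l : G -> int) : Prop :=
  proper_labeling l /\ closed_nonzero_coloring n l.

(* [is_chi n G k] states that chi_n(G) exists and equals k; a relation is used
   because a graph need not have any admissible labeling. *)
Definition is_chi (n : nat) (G : sgraph) (k : nat) : Prop :=
  (exists2 l : G -> int, admissible n l & labeling_order l = k) /\
  (forall l : G -> int, admissible n l -> (k <= labeling_order l)%N).

(* A vertex of T_{m,d} is the word over 'I_m, of length at most d, listing the
   choices of child made along the path from the vertex up to the root; the
   root is the empty word and the length of a word is its depth. *)
Definition tree_vertex (m d : nat) : finType := d.-bseq 'I_m.

Definition is_child (m d : nat) (v u : tree_vertex m d) : bool :=
  [exists i : 'I_m, val v == i :: val u].

Definition tree_adj (m d : nat) : rel (tree_vertex m d) :=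
  [rel u v | is_child u v || is_child v u].

Lemma tree_adj_sym (m d : nat) : symmetric (@tree_adj m d).
Proof. by move=> u v; rewrite /tree_adj /= orbC. Qed.

Lemma tree_adj_irrefl (m d : nat) : irreflexive (@tree_adj m d).
Proof.
move=> u; rewrite /tree_adj /= orbb; apply/existsP=> -[i /eqP/(congr1 size)] /=.
by move/eqP; rewrite -addn1 -{1}[size _]addn0 eqn_add2l.
Qed.

Definition complete_tree (m d : nat) : sgraph :=
  SGraph (@tree_adj_sym m d) (@tree_adj_irrefl m d).

Lemma card_children (m d : nat) (u : tree_vertex m d) :
  #|[set v | is_child v u]| = if (size u < d)%N then m else 0%N.
Proof.
case: ifPn => [lt_u_d | ].
  pose f (i : 'I_m) : tree_vertex m d := Bseq (lt_u_d : (size (i :: u) <= d)%N).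
  have f_inj : injective f by move=> i j /(congr1 val) [].
  suff -> : [set v | is_child v u] = f @: setT by rewrite card_imset // cardsT card_ord.
  apply/setP=> v; rewrite inE; apply/existsP/imsetP.
    by case=> i /eqP ei; exists i; rewrite ?inE //; apply/val_inj.
  by case=> i _ ->; exists i.
rewrite -leqNgt => le_d_u; apply/eqP; rewrite cards_eq0; apply/eqP/setP=> v.
rewrite !inE; apply/existsP=> -[i /eqP ei].
by have := size_bseq v; rewrite ei /= ltnNge le_d_u.
Qed.

(* Main.v *)
(* A proper labeling of the tree with two labels takes one value a at even
   depths and another value b at odd depths.  For d >= 3 the closed sums are
   then exactly a + m b, a + b, a + (m+1) b and b + (m+1) a; when n | m + 1
   they are congruent to a - b, a + b, a and b, which cannot all be nonzero
   mod 2 or mod 3, while (a, b) = (1, 2) works for n >= 4.  If n does not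
   divide m + 1, (a, b) = (1, 0) works, and if n | m + 1 and d = 2,
   (a, b) = (0, 1) does.  Otherwise three labels depending only on the depth
   suffice: 2, 1, 4, 1, 4, ... for n = 3, and a shift of 1, 0, 2, 1, 0, 2, ...
   for n = 2, where any three consecutive labels have an odd sum. *)
Require Import Defs.
From mathcomp Require Import all_boot all_order all_algebra.
From mathcomp Require Import zify ring.

Set Implicit Arguments.
Unset Strict Implicit.
Unset Printing Implicit Defensive.

Import GRing.Theory Num.Theory.
Local Open Scope ring_scope.

(** * Counting labels, and nonzero remainders *)

Lemma labeling_orderE (G : sgraph) (l : G -> int) (s : seq int) :
  uniq s -> codom l =i s -> labeling_order l = size s.
Proof.
move=> us ls; apply: perm_size; apply: uniq_perm; rewrite ?undup_uniq //.
by move=> x; rewrite mem_undup ls.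
Qed.

Lemma labeling_order_ge (G : sgraph) (l : G -> int) (s : seq int) :
  uniq s -> {subset s <= codom l} -> (size s <= labeling_order l)%N.
Proof.
by move=> us sub; apply: uniq_leq_size => // x /sub; rewrite mem_undup.
Qed.

Lemma proper_labeling_order_ge2 (G : sgraph) (l : G -> int) (u v : G) :
  proper_labeling l -> adj u v -> (2 <= labeling_order l)%N.
Proof.
move=> pl /pl luv; apply: (@labeling_order_ge _ _ [:: l u; l v]) => /=.
  by rewrite inE andbT; apply/eqP.
by move=> x; rewrite !inE => /orP[] /eqP ->; exact: codom_f.
Qed.

(** With [m = q * n - 1], closed sums take the form [t * n + r], and this tests them. *)
Lemma small_remainder_neq0 (n : nat) (t r : int) :
  r != 0 -> (`|r| < n)%N -> (t * n%:Z + r <> 0 %[mod n%:Z])%Z.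
Proof.
move=> r0 rn /eqP; rewrite modzMDl eqz_mod_dvd subr0 dvdzE /= => /dvdn_leq.
by rewrite absz_gt0 r0 leqNgt rn => /(_ isT).
Qed.

Lemma one_remainder_neq0 (n : nat) : (2 <= n)%N -> (1 <> 0 %[mod n%:Z])%Z.
Proof. by have := @small_remainder_neq0 n 0 1; rewrite mul0r add0r; apply. Qed.

(** * Depth, closed sums and two-label rigidity in the tree *)

Section Tree.
Variables m d : nat.
Implicit Types u v w : complete_tree m d.

Lemma size_child u v : is_child v u -> size v = (size u).+1.
Proof. by case/existsP => i /eqP /(congr1 size). Qed.

Lemma parent_inj u v w : is_child v u -> is_child v w -> u = w.
Proof.
by move=> /existsP[i /eqP e] /existsP[j /eqP]; rewrite e => -[_ /val_inj].
Qed.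

Lemma exists_parent v : (0 < size v)%N -> exists u, is_child v u.
Proof.
case: v => -[//|i s] /= sd _; exists (Bseq (ltnW sd)).
by apply/existsP; exists i.
Qed.

Lemma exists_child u : (0 < m)%N -> (size u < d)%N -> exists v, is_child v u.
Proof.
move=> m0 ud; exists (Bseq (ud : (size (Ordinal m0 :: u) <= d)%N)).
by apply/existsP; exists (Ordinal m0).
Qed.

Lemma exists_depth k : (0 < m)%N -> (k <= d)%N ->
  exists v : complete_tree m d, size v = k.
Proof.
move=> m0 kd; have sk : (size (nseq k (Ordinal m0)) <= d)%N by rewrite size_nseq.
by exists (Bseq sk); rewrite /= size_nseq.
Qed.

(** The zero defaults stand for the missing children of a leaf and the missing parent of the
    root. *)
Definition depth_sum (f : nat -> int) (k : nat) : int :=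
  f k + (if (k < d)%N then m%:Z * f k.+1 else 0) + (if k is j.+1 then f j else 0).

(** A closed neighborhood splits into the vertex, its children (all one level deeper) and its at
    most one parent. *)
Lemma closed_sum_depth (f : nat -> int) v :
  \sum_(w in closed_nbhd v) f (size w) = depth_sum f (size v).
Proof.
have disj w : ~~ (is_child w v && is_child v w).
  by apply/negP => /andP[/size_child e1 /size_child e2]; lia.
have irr : ~~ is_child v v by apply/negP => /size_child; lia.
rewrite (eq_bigl (fun w => [|| w == v, is_child w v | is_child v w])); last first.
  by move=> w; rewrite inE /= /tree_adj /= [is_child v w || _]orbC.
rewrite (bigD1 v) ?eqxx //= /depth_sum -addrA; congr (_ + _).
rewrite (bigID (fun w => is_child w v)) /=; congr (_ + _).
  rewrite (eq_bigl (fun w => w \in [set w | is_child w v])); last first.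
    move=> w; rewrite inE; case: eqP => [->|_] /=; first by rewrite (negPf irr).
    by rewrite andbT; case: (is_child w v); rewrite ?andbF.
  rewrite (eq_bigr (fun=> f (size v).+1)) => [|w]; last first.
    by rewrite inE => /size_child ->.
  rewrite sumr_const card_children; case: ifP => _ //.
  by rewrite -mulr_natl natz.
rewrite (eq_bigl (fun w => is_child v w)); last first.
  move=> w; case: eqP => [->|_] /=; first by rewrite (negPf irr).
  by have := disj w; case: (is_child w v); case: (is_child v w).
case ev: (size v) => [|k].
  by rewrite big_pred0 // => w; apply/idP => /size_child; rewrite ev.
have [|u vu] := @exists_parent v; first by rewrite ev.
rewrite (big_pred1 u) => [|w].
  by have := size_child vu; rewrite ev => -[->].
by apply/idP/eqP => [vw|-> //]; exact: parent_inj vw vu.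
Qed.

Lemma depth_labeling_admissible n (f : nat -> int) :
  (forall k, (k < d)%N -> f k <> f k.+1) ->
  (forall k, (k <= d)%N -> (depth_sum f k <> 0 %[mod n%:Z])%Z) ->
  admissible n (fun v : complete_tree m d => f (size v)).
Proof.
move=> fP fn; split=> [u v|v]; last first.
  by rewrite closed_sum_depth; apply: fn; exact: size_bseq.
have bound w : (size w <= d)%N by exact: size_bseq.
case/orP => /size_child e; rewrite e.
  by apply/nesym/fP; rewrite -e.
by apply: fP; rewrite -e.
Qed.

Lemma depth_labeling_order (f : nat -> int) (s : seq int) :
  (0 < m)%N -> uniq s ->
  (forall k, (k <= d)%N -> f k \in s) ->
  (forall x, x \in s -> exists2 k, (k <= d)%N & f k = x) ->
  labeling_order (fun v : complete_tree m d => f (size v)) = size s.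
Proof.
move=> m0 us fs sf; apply: labeling_orderE => // x; apply/codomP/idP.
  by case=> v ->; apply: fs; exact: size_bseq.
case/sf => k kd <-; have [v vk] := exists_depth m0 kd.
by exists v; rewrite vk.
Qed.

(** The root and one of its children already use both labels, so properness forces a switch at each
    step down from the root. *)
Lemma two_labels_alternate (l : complete_tree m d -> int) :
  (0 < m)%N -> (0 < d)%N -> proper_labeling l -> (labeling_order l <= 2)%N ->
  exists a b : int, forall v, l v = if odd (size v) then b else a.
Proof.
move=> m0 d0 pl ol.
have [r r0] := exists_depth m0 (leq0n d).
have [c cr] : exists c, is_child c r by apply: exists_child; rewrite ?r0.
have step u v : is_child v u -> l v <> l u.
  by move=> vu; apply: pl; rewrite /= /tree_adj /= vu.
have lcr := step _ _ cr.
have lP v : (l v == l r) || (l v == l c).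
  apply/negPn/negP; rewrite negb_or => /andP[vr vc].
  move: ol; rewrite leqNgt => /negP; apply.
  apply: (@labeling_order_ge _ _ [:: l v; l r; l c]) => /=.
    by rewrite !inE negb_or vr vc /= andbT; apply/eqP => e; apply: lcr; rewrite e.
  by move=> x; rewrite !inE => /or3P[] /eqP ->; exact: codom_f.
exists (l r), (l c) => v; move: {2}(size v) (erefl (size v)) => k.
elim: k v => [|k IH] v vk.
  suff -> : v = r by rewrite r0.
  by apply/val_inj; rewrite /= (size0nil vk) (size0nil r0).
have [|u vu] := @exists_parent v; first by rewrite vk.
have := size_child vu; rewrite vk => -[uk].
have := IH u (esym uk); have := step _ _ vu; have := lP v.
rewrite -uk /=; case: (odd k) => /=.
  by move=> /orP[/eqP ->|/eqP ->] // + e; rewrite e.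
by move=> /orP[/eqP ->|/eqP ->] // + e; rewrite e.
Qed.

(** The sums are read off at the root, a leaf, depth 2 and depth 1; [3 <= d] makes depth 2
    internal. *)
Lemma alternating_sums n (a b : int) :
  (0 < m)%N -> (3 <= d)%N ->
  closed_nonzero_coloring n
    (fun v : complete_tree m d => if odd (size v) then b else a) ->
  [/\ (a + m%:Z * b <> 0 %[mod n%:Z])%Z, (a + b <> 0 %[mod n%:Z])%Z,
      (a + m.+1%:Z * b <> 0 %[mod n%:Z])%Z & (b + m.+1%:Z * a <> 0 %[mod n%:Z])%Z].
Proof.
move=> m0 d3 H; pose f k : int := if odd k then b else a.
have K k : (k <= d)%N -> (depth_sum f k <> 0 %[mod n%:Z])%Z.
  move=> kd; have [v vk] := exists_depth m0 kd.
  by have := H v; rewrite (closed_sum_depth f) vk.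
have d1 : (1 < d)%N by lia.
have d0 : (0 < d)%N by lia.
split.
- by have := K 0%N (leq0n d); rewrite /depth_sum /f d0 /= addr0.
(* The parity of [d] only decides the order of the two summands. *)
- have := K d (leqnn d); rewrite /depth_sum /f ltnn addr0.
  case: d d0 => // e _ /=; case: (odd e) => //=.
  by rewrite addrC.
- have := K 2 d1; rewrite /depth_sum /f d3 /=.
  by rewrite -addrA -[m.+1]addn1 PoszD mulrDl mul1r.
- have := K 1%N d0; rewrite /depth_sum /f d1 /=.
  by rewrite -addrA -[m.+1]addn1 PoszD mulrDl mul1r.
Qed.

End Tree.

Lemma no_two_labels (n m d : nat) (l : complete_tree m d -> int) :
  (2 <= n < 4)%N -> (0 < m)%N -> (3 <= d)%N -> (n %| m.+1)%N ->
  admissible n l -> (3 <= labeling_order l)%N.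
Proof.
move=> hn m0 d3 /dvdnP[q em] [pl cl]; rewrite ltnNge; apply/negP => ol.
have [|a [b lab]] := two_labels_alternate m0 _ pl ol; first by lia.
have [] := @alternating_sums m d n a b m0 d3.
  by move=> v; rewrite (eq_bigr l) // => w _; rewrite lab.
have -> : m%:Z = q%:Z * n%:Z - 1 by lia.
have -> : m.+1%:Z = q%:Z * n%:Z by lia.
have -> : a + (q%:Z * n%:Z - 1) * b = q%:Z * b * n%:Z + (a - b) by ring.
have -> : a + q%:Z * n%:Z * b = q%:Z * b * n%:Z + a by ring.
have -> : b + q%:Z * n%:Z * a = q%:Z * a * n%:Z + b by ring.
rewrite !modzMDl.
(* Mod 2, nonzero [a] and [b] are both odd, so [a + b] vanishes; mod 3, they are equal or opposite,
   so [a - b] or [a + b] vanishes. *)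
have [->|->] : n = 2 \/ n = 3 by lia.
  by lia.
by lia.
Qed.

(** * Labelings attaining the minimum *)

Section Constructions.
Variables m d : nat.
Hypotheses (m_gt0 : (0 < m)%N) (d_ge2 : (2 <= d)%N).

Lemma alternating_order (a b : int) : a != b ->
  labeling_order (fun v : complete_tree m d => if odd (size v) then b else a) = 2.
Proof.
move=> ab.
apply: (@depth_labeling_order m d (fun k => if odd k then b else a) [:: a; b]) => //.
- by rewrite /= inE ab.
- by move=> k _; rewrite !inE; case: (odd k); rewrite eqxx ?orbT.
move=> x; rewrite !inE => /orP[]/eqP ->; first by exists 0%N.
by exists 1%N => //; exact: ltnW.
Qed.

(** Even depths and odd leaves have sum 1; other odd depths have sum [m + 1]. *)
Lemma two_labels_ndvd n : (2 <= n)%N -> ~~ (n %| m.+1)%N ->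
  exists2 l : complete_tree m d -> int, admissible n l & labeling_order l = 2.
Proof.
move=> n2 nm; exists (fun v : complete_tree m d => if odd (size v) then 0 else 1 : int); last first.
  exact: alternating_order.
apply: (@depth_labeling_admissible m d n (fun k => if odd k then 0 else 1 : int)).
  by move=> k _ /=; case: (odd k).
have one := one_remainder_neq0 n2.
move=> [|k] kd; rewrite /depth_sum /=; first by rewrite mulr0 if_same !addr0.
case: (odd k) => /=; first by rewrite mulr0 if_same !addr0.
case: ifP => _ //; rewrite mulr1 add0r -[1]/1%:Z -PoszD addn1.
by move/eqP; rewrite eqz_mod_dvd subr0 dvdzE /= (negPf nm).
Qed.

(** The sums are [m], congruent to -1, at the root and 1 elsewhere. An internal vertex at positive
    even depth would have sum [m + 1], but height 2 has none. *)
Lemma two_labels_height2 n : (2 <= n)%N -> (n %| m.+1)%N -> d = 2 ->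
  exists2 l : complete_tree m d -> int, admissible n l & labeling_order l = 2.
Proof.
move=> n2 /dvdnP[q em] d2; exists (fun v : complete_tree m d => if odd (size v) then 1 else 0 : int); last first.
  exact: alternating_order.
apply: (@depth_labeling_admissible m d n (fun k => if odd k then 1 else 0 : int)).
  by move=> k _ /=; case: (odd k).
have mq : m%:Z = q%:Z * n%:Z - 1 by lia.
rewrite /depth_sum d2 mq => -[|[|[|//]]] _ /=.
- rewrite (_ : _ + _ = q%:Z * n%:Z - 1); last by ring.
  by apply: small_remainder_neq0.
- by rewrite mulr0 !addr0; exact: one_remainder_neq0.
- by rewrite !add0r; exact: one_remainder_neq0.
Qed.

Lemma two_labels_ge4 n : (4 <= n)%N -> (n %| m.+1)%N ->
  exists2 l : complete_tree m d -> int, admissible n l & labeling_order l = 2.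
Proof.
move=> n4 /dvdnP[q em]; exists (fun v : complete_tree m d => if odd (size v) then 2 else 1 : int); last first.
  exact: alternating_order.
apply: (@depth_labeling_admissible m d n (fun k => if odd k then 2 else 1 : int)).
  by move=> k _ /=; case: (odd k).
have mq : m%:Z = q%:Z * n%:Z - 1 by lia.
(* The remainders that occur are -1, 1, 2 and 3, all below 4 in absolute value. *)
have R t (r x : int) : x = t * n%:Z + r -> r != 0 -> (`|r| < 4)%N ->
    (x <> 0 %[mod n%:Z])%Z.
  by move=> -> r0 r4; apply: small_remainder_neq0 => //; exact: leq_trans n4.
move=> k kd; rewrite /depth_sum mq; case: k kd => [|k] kd /=.
  rewrite ltnW //.
  by apply: (R (2 * q%:Z) (-1)) => //; ring.
case: (odd k) => /=; case: ifP => _.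
- by apply: (R (2 * q%:Z) 1) => //; ring.
- by apply: (R 0 3) => //; ring.
- by apply: (R q%:Z 2) => //; ring.
- by apply: (R 0 3) => //; ring.
Qed.

Lemma three_labels_mod3 : (3 %| m.+1)%N ->
  exists2 l : complete_tree m d -> int, admissible 3 l & labeling_order l = 3.
Proof.
move=> /dvdnP[q em].
(* As 4 is 1 mod 3, the alternation of 1 and 4 gives properness while the residue stays 1 below the
   root. The sums mod 3 are 1 at the root, 2 at depth 1, 1 at deeper internal vertices and 2 at
   leaves. *)
pose f k : int := if k == 0%N then 2 else if odd k then 1 else 4.
exists (fun v : complete_tree m d => f (size v)).
  apply: depth_labeling_admissible.
    by move=> -[|k] _ //; rewrite /f /=; case: (odd k).
  have mq : m%:Z = q%:Z * 3 - 1 by lia.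
  move=> [|[|k]] kd; rewrite /depth_sum /f mq /=.
  - by rewrite ltnW //; lia.
  - by rewrite d_ge2; lia.
  - by case: (odd k) => /=; case: ifP => _; lia.
apply: (@depth_labeling_order m d f [:: 2; 1; 4]) => //.
  by move=> k _; rewrite /f; case: eqP => // _; case: (odd k).
move=> x; rewrite !inE => /or3P[]/eqP ->.
- by exists 0%N.
- by exists 1%N; first exact: ltnW.
- by exists 2.
Qed.

(* The shift makes the root and leaf sums odd: mod 2 each is the sum of two
   consecutive labels, which is odd unless they are 0 and 2. *)
Lemma three_labels_mod2 : (2 %| m.+1)%N ->
  exists2 l : complete_tree m d -> int, admissible 2 l & labeling_order l = 3.
Proof.
move=> /dvdnP[q em].
pose g k : int := nth 0 [:: 1; 0; 2] (k %% 3).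
(* The leaf sum is even exactly when [d + c] is 2 mod 3. Taking [c = 0] fails only for [d] equal to
   2 mod 3; then [c = 2] makes [d + c] equal to 1 mod 3, and the root sees labels 2 and 1. *)
pose c := if (d %% 3 == 2)%N then 2 else 0%N.
have cP : (c = 2 /\ d %% 3 = 2 \/ c = 0 /\ d %% 3 <> 2)%N.
  by rewrite /c; case: eqP; [left|right].
have gE k : (g k = 1 /\ k %% 3 = 0 \/ g k = 0 /\ k %% 3 = 1 \/ g k = 2 /\ k %% 3 = 2)%N.
  rewrite /g; have : (k %% 3 < 3)%N by rewrite ltn_mod.
  by case: (k %% 3)%N => [|[|[|//]]] _; auto.
exists (fun v : complete_tree m d => g (size v + c)%N).
  apply: (@depth_labeling_admissible m d 2 (fun k => g (k + c)%N)).
    by move=> k _ /=; have := gE (k + c)%N; have := gE (k.+1 + c)%N; lia.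
  have mq : m%:Z = q%:Z * 2 - 1 by lia.
  move=> k kd; rewrite /depth_sum mq.
  have := gE (k + c)%N; have := gE (k.+1 + c)%N.
  case: k kd => [|k] kd.
    by rewrite ltnW //; lia.
  have := gE (k + c)%N.
  case: ltnP => dk; last by lia.
  by lia.
apply: (@depth_labeling_order m d (fun k => g (k + c)%N) [:: 1; 0; 2]) => //.
  by move=> k _; rewrite !inE; have := gE (k + c)%N; lia.
have hit k : (k <= 2)%N -> exists2 j, (j <= d)%N & g (j + c)%N = g k.
  (* This solves [j + c = k] mod 3 with [j <= 2 <= d]; adding 3 keeps the subtraction from
     truncating. *)
  move=> k2; exists ((k + 3 - c) %% 3)%N; first by lia.
  by rewrite /g; congr (nth _ _ _); lia.
move=> x; rewrite !inE => /or3P[]/eqP ->.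
- exact: (hit 0%N).
- exact: (hit 1%N).
- exact: (hit 2).
Qed.

End Constructions.

Local Close Scope ring_scope.

Theorem theorem4p7 (n m d : nat) (hn : 2 <= n) (hm : 2 <= m) (hd : 2 <= d) :
  is_chi n (complete_tree m d)
    (if [|| 4 <= n, ~~ (n %| m + 1) | d == 2] then 2 else 3).
Proof.
have m0 : 0 < m by exact: ltnW.
have d0 : 0 < d by exact: ltnW.
rewrite addn1; case: ifPn => [two|].
  split.
    have [nm|nm] := boolP (n %| m.+1); last exact: two_labels_ndvd.
    move: two; rewrite nm /= => /orP[n4|/eqP d2]; first exact: two_labels_ge4.
    exact: two_labels_height2.
  (* The edge from the root to a child forces two labels. *)
  move=> l [pl _]; have [r r0] := exists_depth m0 (leq0n d).
  have [|c cr] := exists_child (u := r) m0; first by rewrite r0.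
  by apply: (proper_labeling_order_ge2 (u := r) (v := c) pl); rewrite /= /tree_adj /= cr orbT.
rewrite !negb_or negbK -ltnNge => /and3P[n4 nm d2].
split; last first.
  by move=> l; apply: no_two_labels => //; [rewrite hn | rewrite ltn_neqAle eq_sym d2].
have [en|en] : n = 2 \/ n = 3 by lia.
  by subst n; exact: three_labels_mod2.
by subst n; exact: three_labels_mod3.
Qed.
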